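(* Let $1\to A\to S\to G\to 1$ be a central extension of finite groups, $F$ a field of characteristic not dividing the order of $A$, and $[\alpha]\in H^2(S,F^* )$ a cohomology class inflated from an element of $H^2(G,F^* )$. Then $$F^\alpha S\cong\bigoplus_{\chi\in\mathrm{Irr}(A,F)}F(\chi)^{\alpha_\chi}G.$$
   Context: All cohomology is with trivial action. For a field $E$, a finite group $X$ and $\gamma\in Z^2(X,E^* )$, the twisted group algebra $E^\gamma X$ has $E$-basis $\{u_x\}_{x\in X}$, multiplication $u_xu_y=\gamma(x,y)u_{xy}$, and $E$ central; up to isomorphism it depends only on $[\gamma]$. Isomorphisms are of rings ($F$-algebras). A cocycle $\alpha\in Z^2(S,F^* )$ is inflated from $\alpha'\in Z^2(G,F^* )$ if $\alpha(x,y)=\alpha'(\bar x,\bar y)$ for all $x,y\in S$, where $\bar{\ }:S\to G$ is the projection. Fix $\alpha'\in Z^2(G,F^* )$ with $[\alpha]$ inflated from $[\alpha']$, and fix a $2$-cocycle $\sigma\in Z^2(G,A)$ whose class corresponds to the given central extension (this fixes a section $G\to S$). Let $K$ be a field containing $F$ and a primitive $\exp(A)$-th root of unity. Identify $\mathrm{Hom}(A,K^* )$ with the irreducible $K$-characters of the abelian group $A$. Let $\mathcal{M}$ be the set of simple $FA$-modules up to isomorphism. $\mathrm{Irr}(A,F)$ denotes a subset of $\mathrm{Hom}(A,K^* )$ containing, for each $M\in\mathcal{M}$, exactly one character which corresponds to a composition factor of $K\otimes_F M$ (so $|\mathcal{M}|=|\mathrm{Irr}(A,F)|$). For $\chi\in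 \mathrm{Hom}(A,K^* )$, $F(\chi)\subseteq K$ is the smallest extension field of $F$ containing all values of $\chi$, and $\alpha_\chi\in Z^2(G,F(\chi)^* )$ is the cocycle $\alpha_\chi(g,h)=\alpha'(g,h)\,\chi(\sigma(g,h))$. *)

(* Defs.v *)
From HB Require Import structures.
From mathcomp Require Import all_boot all_order all_algebra all_fingroup.
From mathcomp Require Import all_solvable all_character.
From mathcomp Require Import finmap.
From mathcomp Require Import boolp.

Set Implicit Arguments.
Unset Strict Implicit.
Unset Printing Implicit Defensive.

Import GRing.Theory.
Local Open Scope ring_scope.

(* Z^2(X, E^* ): cocycles are not assumed to be normalized. *)
Record cocycle2 (X : finGroupType) (E : fieldType) := Cocycle2 {
  cocycle2_fun :> X -> X -> E;
  cocycle2_neq0 : forall x y, cocycle2_fun x y != 0;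
  cocycle2P : forall x y z,
    cocycle2_fun x y * cocycle2_fun (x * y)%g z =
    cocycle2_fun y z * cocycle2_fun x (y * z)%g }.

Definition cohomologous (X : finGroupType) (E : fieldType)
    (a b : X -> X -> E) : Prop :=
  exists2 l : X -> E, forall x, l x != 0 &
    forall x y, a x y = b x y * (l x * l y / l (x * y)%g).

Definition inflation (sT gT : finGroupType) (E : fieldType)
    (p : sT -> gT) (a : gT -> gT -> E) : sT -> sT -> E :=
  fun x y => a (p x) (p y).

(* Z^2(G, A) for a finite group A; A is only used when it is abelian. *)
Record gcocycle2 (gT aT : finGroupType) := GCocycle2 {
  gcocycle2_fun :> gT -> gT -> aT;
  gcocycle2P : forall x y z,
    (gcocycle2_fun x y * gcocycle2_fun (x * y) z =
     gcocycle2_fun y z * gcocycle2_fun x (y * z))%g }.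

Definition gcohomologous (gT aT : finGroupType) (a b : gT -> gT -> aT) : Prop :=
  exists l : gT -> aT,
    forall x y, (a x y = b x y * (l x * l y * (l (x * y))^-1))%g.

Section CentralExtension.
Variables (aT sT gT : finGroupType).
Variables (i : {morphism [set: aT] >-> sT}) (p : {morphism [set: sT] >-> gT}).

Definition central_extension : Prop :=
  [/\ 'injm i, i @* [set: aT] = 'ker p, p @* [set: sT] = [set: gT]
    & i @* [set: aT] \subset 'Z([set: sT])]%g.

(* The cocycle of a set-theoretic section s is sigma0 below. *)
Definition extension_class (sigma : gT -> gT -> aT) : Prop :=
  exists (s : gT -> sT) (sigma0 : gT -> gT -> aT),
    [/\ cancel s p,
        forall g h, (s g * s h = i (sigma0 g h) * s (g * h))%g
      & gcohomologous sigma sigma0].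

End CentralExtension.

(* The function a : X -> E stands for the sum of the a x *: u_x. *)
Definition twalg (X : finGroupType) (E : fieldType) (c : cocycle2 X E) : Type :=
  {ffun X -> E^o}.

Section TwistedGroupAlgebra.
Variables (X : finGroupType) (E : fieldType) (c : cocycle2 X E).
Local Notation A := (twalg c).

HB.instance Definition _ := GRing.Lmodule.copy A {ffun X -> E^o}.

Implicit Types a b d : A.

Definition twbasis (x : X) : A := [ffun y => (y == x)%:R].

Definition twmul a b : A :=
  [ffun z => \sum_x a x * b (x^-1 * z)%g * c x (x^-1 * z)%g].

Definition twone : A := (c 1%g 1%g)^-1 *: twbasis 1%g.

Fact cocycle2_1l x : c 1%g x = c 1%g 1%g.
Proof.
have := cocycle2P c 1%g 1%g x; rewrite !mul1g => h.
by apply: (mulIf (cocycle2_neq0 c 1%g x)); rewrite -h.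
Qed.

Fact cocycle2_1r x : c x 1%g = c 1%g 1%g.
Proof.
have := cocycle2P c x 1%g 1%g; rewrite !mulg1 => h.
by apply: (mulIf (cocycle2_neq0 c x 1%g)); rewrite h.
Qed.

Fact twmulA : associative twmul.
Proof.
move=> a b d; apply/ffunP=> z; rewrite !ffunE.
under [RHS]eq_bigr => y _ do rewrite ffunE !mulr_suml.
rewrite exchange_big /=; apply: eq_bigr => x _.
rewrite ffunE mulr_sumr mulr_suml.
rewrite [RHS](reindex_inj (mulgI x)) /=; apply: eq_bigr => y _.
rewrite mulKg invMg -!mulgA.
have := cocycle2P c x y (y^-1 * (x^-1 * z))%g; rewrite mulKVg => h.
rewrite -!mulrA; congr (_ * (_ * _)).
by rewrite -h mulrCA.
Qed.

Fact twmul1 : left_id twone twmul.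
Proof.
move=> a; apply/ffunP=> z; rewrite ffunE (bigD1 1%g) //= !ffunE eqxx.
rewrite big1 => [|x /negPf nx]; last by rewrite !ffunE nx /= scaler0 !mul0r.
by rewrite addr0 invg1 mul1g cocycle2_1l [_ *: _]mulr1 mulrAC mulVf ?mul1r
  ?cocycle2_neq0.
Qed.

Fact twmulr1 : right_id twone twmul.
Proof.
move=> a; apply/ffunP=> z; rewrite ffunE (bigD1 z) //= !ffunE mulVg eqxx.
rewrite big1 => [|x nx]; last first.
  rewrite !ffunE -eq_mulVg1 (negPf nx) /=.
  by rewrite scaler0 mulr0 mul0r.
by rewrite addr0 cocycle2_1r [_ *: _]mulr1 -mulrA mulVf ?mulr1 ?cocycle2_neq0.
Qed.

Fact twmulDl : left_distributive twmul +%R.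
Proof.
move=> a b d; apply/ffunP=> z; rewrite !ffunE -big_split /=.
by apply: eq_bigr => x _; rewrite !ffunE !mulrDl.
Qed.

Fact twmulDr : right_distributive twmul +%R.
Proof.
move=> a b d; apply/ffunP=> z; rewrite !ffunE -big_split /=.
by apply: eq_bigr => x _; rewrite !ffunE mulrDr mulrDl.
Qed.

Fact twone_neq0 : twone != 0.
Proof.
apply/eqP => /ffunP/(_ 1%g); rewrite !ffunE eqxx => /eqP.
by rewrite scaler_eq0 invr_eq0 oner_eq0 (negPf (cocycle2_neq0 _ _ _)).
Qed.

HB.instance Definition _ := GRing.Zmodule_isNzRing.Build A
  twmulA twmul1 twmulr1 twmulDl twmulDr twone_neq0.

Fact twscaleAl (k : E) (a b : A) : k *: (a * b) = (k *: a) * b.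
Proof.
apply/ffunP=> z; rewrite !ffunE scaler_sumr; apply: eq_bigr => x _.
by rewrite ffunE -!mulrA.
Qed.

HB.instance Definition _ := GRing.Lmodule_isLalgebra.Build E A twscaleAl.

Fact twscaleAr (k : E) (a b : A) : k *: (a * b) = a * (k *: b).
Proof.
apply/ffunP=> z; rewrite !ffunE scaler_sumr; apply: eq_bigr => x _.
by rewrite ffunE [k *: _]mulrA [k *: b _]/(k * _) -!mulrA mulrCA.
Qed.

HB.instance Definition _ := GRing.Lalgebra_isAlgebra.Build E A twscaleAr.

Lemma twbasisM x y : twbasis x * twbasis y = c x y *: twbasis (x * y)%g.
Proof.
apply/ffunP=> z; rewrite ffunE (bigD1 x) //= big1 => [|t /negPf nt].
  rewrite !ffunE eqxx mul1r addr0 -(inj_eq (mulgI x)) mulKVg.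
  have [->|_] := eqVneq z; first by rewrite mulKg mul1r [_ *: _]mulr1.
  by rewrite mul0r scaler0.
by rewrite !ffunE nt !mul0r.
Qed.

Lemma twalg_sum a : a = \sum_x a x *: twbasis x.
Proof.
apply/ffunP=> z; rewrite sum_ffunE (bigD1 z) //= big1 => [|x /negPf nx].
  by rewrite !ffunE eqxx addr0 [_ *: _]mulr1.
by rewrite !ffunE eq_sym nx scaler0.
Qed.

End TwistedGroupAlgebra.

Definition dsum (I : finType) (R : I -> pzRingType) : Type :=
  {dffun forall i, R i}.

Section DirectSum.
Variables (I : finType) (R : I -> pzRingType).
Local Notation D := (dsum R).

HB.instance Definition _ := Choice.on D.

Definition mkdsum (f : forall i, R i) : D := finfun f.

Implicit Types a b d : D.

Fact mkdsumE (f : forall i, R i) i : mkdsum f i = f i.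
Proof. by rewrite ffunE. Qed.

Definition dsum_add a b := mkdsum (fun i => a i + b i).
Definition dsum_opp a := mkdsum (fun i => - a i).
Definition dsum_mul a b := mkdsum (fun i => a i * b i).

Fact dsum_addA : associative dsum_add.
Proof. by move=> a b d; apply/ffunP=> i; rewrite !mkdsumE addrA. Qed.
Fact dsum_addC : commutative dsum_add.
Proof. by move=> a b; apply/ffunP=> i; rewrite !mkdsumE addrC. Qed.
Fact dsum_add0 : left_id (mkdsum (fun=> 0)) dsum_add.
Proof. by move=> a; apply/ffunP=> i; rewrite !mkdsumE add0r. Qed.
Fact dsum_addN : left_inverse (mkdsum (fun=> 0)) dsum_opp dsum_add.
Proof. by move=> a; apply/ffunP=> i; rewrite !mkdsumE addNr. Qed.

HB.instance Definition _ := GRing.isZmodule.Build D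
  dsum_addA dsum_addC dsum_add0 dsum_addN.

Fact dsum_mulA : associative dsum_mul.
Proof. by move=> a b d; apply/ffunP=> i; rewrite !mkdsumE mulrA. Qed.
Fact dsum_mul1 : left_id (mkdsum (fun=> 1)) dsum_mul.
Proof. by move=> a; apply/ffunP=> i; rewrite !mkdsumE mul1r. Qed.
Fact dsum_mulr1 : right_id (mkdsum (fun=> 1)) dsum_mul.
Proof. by move=> a; apply/ffunP=> i; rewrite !mkdsumE mulr1. Qed.
Fact dsum_mulDl : left_distributive dsum_mul dsum_add.
Proof. by move=> a b d; apply/ffunP=> i; rewrite !mkdsumE mulrDl. Qed.
Fact dsum_mulDr : right_distributive dsum_mul dsum_add.
Proof. by move=> a b d; apply/ffunP=> i; rewrite !mkdsumE mulrDr. Qed.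

HB.instance Definition _ := GRing.Zmodule_isPzRing.Build D
  dsum_mulA dsum_mul1 dsum_mulr1 dsum_mulDl dsum_mulDr.

End DirectSum.

Section Characters.
Variables (aT : finGroupType) (F K : fieldType) (iota : {rmorphism F -> K}).

(* Hom(A, K^* ): preserving 1 and products forces the values to be nonzero.
   A boolean subtype of finite functions, so that finite sets of characters
   make sense. *)
Definition is_mulchar (f : {ffun aT -> K}) : bool :=
  (f 1%g == 1) && [forall x, forall y, f (x * y)%g == f x * f y].

Record mulchar := MulChar {
  mulchar_ffun :> {ffun aT -> K};
  mulchar_ffunP : is_mulchar mulchar_ffun }.

HB.instance Definition _ := [isSub for mulchar_ffun].
HB.instance Definition _ := [Choice of mulchar by <:].

Lemma mulchar1 (chi : mulchar) : chi 1%g = 1.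
Proof. by case: chi => f /= /andP[/eqP]. Qed.

Lemma mulcharM (chi : mulchar) x y : chi (x * y)%g = chi x * chi y.
Proof. by case: chi => f /= /andP[_ /forallP/(_ x)/forallP/(_ y)/eqP]. Qed.

Lemma mulchar_neq0 (chi : mulchar) x : chi x != 0.
Proof.
apply: contra_neq (oner_neq0 K) => chix0.
by rewrite -(mulchar1 chi) -(mulgV x) mulcharM chix0 mul0r.
Qed.

Fact mulchar_mx_repr (chi : mulchar) :
  mx_repr [set: aT] (fun x => (chi x)%:M : 'M[K]_1).
Proof. by split=> [|x y _ _]; rewrite ?mulchar1 // mulcharM scalar_mxM. Qed.

Definition mulchar_repr (chi : mulchar) := MxRepresentation (mulchar_mx_repr chi).

Definition mulchar_composition_factor n
    (rA : mx_representation K [set: aT] n) (chi : mulchar) : Prop :=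
  exists (U : seq 'M[K]_n) (compU : mx_composition_series rA U) (j : nat),
    [/\ (last 0%R U :=: 1%:M)%MS, (j < size U)%N
      & mx_rsim (series_repr j compU) (mulchar_repr chi)].

(* Simple FA-modules are finite dimensional, hence given by irreducible matrix
   representations rA of A over F; map_repr iota rA is the extension of scalars
   to K. No further character can occur in I, since every chi is a composition
   factor of the extension of scalars of some simple FA-module. *)
Definition is_Irr (I : {fset mulchar}) : Prop :=
  forall n (rA : mx_representation F [set: aT] n), mx_irreducible rA ->
    exists! chi : mulchar,
      chi \in I /\ mulchar_composition_factor (map_repr iota rA) chi.

Variable chi : mulchar.

Definition in_char_field : pred K := fun x =>
  `[< forall L : {pred K}, divring_closed L ->
        (forall a, iota a \in L) -> (forall t, chi t \in L) -> x \in L >].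

Fact char_field_closed : divring_closed in_char_field.
Proof.
split=> [|x y /asboolP Lx /asboolP Ly|x y /asboolP Lx /asboolP Ly];
  apply/asboolP=> L L_cl LF Lchi; have [L1 LB LV] := L_cl => //.
  by apply: LB; [apply: Lx | apply: Ly].
by apply: LV; [apply: Lx | apply: Ly].
Qed.

HB.instance Definition _ :=
  GRing.isDivringClosed.Build K in_char_field char_field_closed.

Record char_field := CharField {
  char_field_val : K;
  char_field_valP : char_field_val \in in_char_field }.

HB.instance Definition _ := [isSub for char_field_val].
HB.instance Definition _ := [Choice of char_field by <:].
HB.instance Definition _ := [SubChoice_isSubIntegralDomain of char_field by <:].
HB.instance Definition _ := [SubIntegralDomain_isSubField of char_field by <:].

Fact char_field_base a : iota a \in in_char_field.
Proof. by apply/asboolP=> L _ LF _; apply: LF. Qed.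

Fact char_field_mulchar t : chi t \in in_char_field.
Proof. by apply/asboolP=> L _ _; apply. Qed.

Definition char_field_inj (a : F) : char_field := CharField (char_field_base a).

Fact char_field_inj_zmod : zmod_morphism char_field_inj.
Proof. by move=> a b; apply: val_inj; rewrite /= rmorphB. Qed.

Fact char_field_inj_monoid : monoid_morphism char_field_inj.
Proof.
by split=> [|a b]; apply: val_inj; rewrite /= ?rmorph1 ?rmorphM.
Qed.

HB.instance Definition _ :=
  GRing.isZmodMorphism.Build F char_field char_field_inj char_field_inj_zmod.
HB.instance Definition _ :=
  GRing.isMonoidMorphism.Build F char_field char_field_inj char_field_inj_monoid.

Definition char_field_char (t : aT) : char_field :=
  CharField (char_field_mulchar t).

Variables (gT : finGroupType) (alpha' : cocycle2 gT F) (sigma : gcocycle2 gT aT).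

Definition char_cocycle_fun (g h : gT) : char_field :=
  char_field_inj (alpha' g h) * char_field_char (sigma g h).

Fact char_cocycle_neq0 g h : char_cocycle_fun g h != 0.
Proof.
rewrite mulf_neq0 ?fmorph_eq0 ?cocycle2_neq0 //.
by rewrite -(inj_eq val_inj) /= mulchar_neq0.
Qed.

Fact char_cocycleP g h k :
  char_cocycle_fun g h * char_cocycle_fun (g * h)%g k =
  char_cocycle_fun h k * char_cocycle_fun g (h * k)%g.
Proof.
apply: val_inj; rewrite /=.
rewrite mulrACA -rmorphM -mulcharM cocycle2P gcocycle2P.
by rewrite rmorphM mulcharM mulrACA.
Qed.

Definition char_cocycle : cocycle2 gT char_field :=
  Cocycle2 char_cocycle_neq0 char_cocycleP.

End Characters.

(* Main.v *)
From HB Require Import structures.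
Require Import Defs.
From mathcomp Require Import all_boot all_order all_algebra all_fingroup.
From mathcomp Require Import all_solvable all_character.
From mathcomp Require Import finmap.
From mathcomp Require Import boolp ring.

Set Implicit Arguments.
Unset Strict Implicit.
Unset Printing Implicit Defensive.

Import GRing.Theory.
Local Open Scope ring_scope.

(* Write x \in S as i t * s g with t = tau x and g = p x, and let alpha be
   alpha' inflated, times the coboundary of lam. Then for each character chi
   the rule u_x |-> lam x * chi (tau x) * u_(p x) is a ring morphism from
   F^alpha S to F(chi)^(alpha_chi) G, and on the coset of a fixed g it is the
   evaluation b |-> chi(b) of the group algebra FA. So it is enough that FA
   maps bijectively to the product of the F(chi), chi \in Irr(A, F).
     Injectivity: if chi is a factor of the simple module M, then chi(b) = 0
   makes b act singularly, hence trivially, on M; so b kills every simple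
   module, and b = 0 by Maschke.
     Surjectivity: FA maps onto each F(chi), since the image of FA in End(M) is
   a field. Two elements of Irr(A, F) with comparable kernels would both be
   factors of the same simple module, so the kernels are pairwise comaximal. *)

(** * The group algebra acting on modules, its elements being row vectors of coefficients *)

Section GroupRingAction.
Variables (F : fieldType) (gT : finGroupType) (G : {group gT}).
Local Notation reprG := (mx_representation F G).
Implicit Type a : 'rV[F]_#|G|.

Lemma gring_mx_sum n (rG : reprG n) a :
  gring_mx rG a = \sum_j a 0 j *: rG (enum_val j).
Proof.
rewrite /gring_mx /= mulmx_sum_row linear_sum; apply: eq_bigr => j _.
by rewrite linearZ /= rowK mxvecK.
Qed.

Lemma gring_mx_submod n (rG : reprG n) (U : 'M_n) (modU : mxmodule rG U) a :
  gring_mx (submod_repr modU) a = in_submod U (val_submod 1%:M *m gring_mx rG a).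
Proof.
rewrite !gring_mx_sum mulmx_sumr linear_sum; apply: eq_bigr => j _.
by rewrite -scalemxAr linearZ.
Qed.

Lemma gring_mx_factmod n (rG : reprG n) (U : 'M_n) (modU : mxmodule rG U) a :
  gring_mx (factmod_repr modU) a
    = in_factmod U (val_factmod 1%:M *m gring_mx rG a).
Proof.
rewrite !gring_mx_sum mulmx_sumr linear_sum; apply: eq_bigr => j _.
by rewrite -scalemxAr linearZ.
Qed.

Lemma gring_mx_rsim n1 (rG1 : reprG n1) n2 (rG2 : reprG n2) a :
  mx_rsim rG1 rG2 -> gring_mx rG1 a = 0 -> gring_mx rG2 a = 0.
Proof.
move=> /mx_rsim_sym/mx_rsim_def[B [B' _ defG2]] a0.
transitivity (B *m gring_mx rG1 a *m B'); last by rewrite a0 mulmx0 mul0mx.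
rewrite !gring_mx_sum mulmx_sumr mulmx_suml; apply: eq_bigr => j _.
by rewrite defG2 ?enum_valP // -scalemxAr -scalemxAl.
Qed.

Lemma gring_mx_section n (rG : reprG n) (U V : 'M_n)
    (modU : mxmodule rG U) (modV : mxmodule rG V) a :
  gring_mx rG a = 0 -> gring_mx (section_repr modU modV) a = 0.
Proof.
move=> a0; rewrite gring_mx_submod gring_mx_factmod a0.
by rewrite mulmx0 linear0 mulmx0 linear0.
Qed.

(** The rows of [val_submod 1%:M] span [U]; their images under [a] stay in [U], so they vanish as
    soon as their coordinates there do. *)
Lemma gring_mx_submod_eq0 n (rG : reprG n) (U : 'M_n) (modU : mxmodule rG U) a :
  gring_mx (submod_repr modU) a = 0 -> U *m gring_mx rG a = 0.
Proof.
move=> a0; pose X := val_submod (1%:M : 'M_(\rank U)) *m gring_mx rG a.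
have sXU: (X <= U)%MS.
  rewrite /X gring_mx_sum mulmx_sumr summx_sub // => j _; rewrite -scalemxAr scalemx_sub //.
  by rewrite (submx_trans _ (mxmoduleP modU _ (enum_valP j))) // submxMr // val_submod1.
have X0: X = 0 by rewrite -(in_submodK sXU) -gring_mx_submod a0 linear0.
by rewrite -{1}(in_submodK (submx_refl U)) val_submodE -mulmxA -/X X0 mulmx0.
Qed.

Lemma gring_mx_factmod_eq0 n (rG : reprG n) (U : 'M_n) (modU : mxmodule rG U) a :
  gring_mx (factmod_repr modU) a = 0 -> (gring_mx rG a <= U)%MS.
Proof.
move=> a0; rewrite -[X in (X <= _)%MS]mul1mx -(add_sub_fact_mod U 1%:M).
rewrite mulmxDl addmx_sub //.
  rewrite gring_mx_sum mulmx_sumr summx_sub // => j _.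
  rewrite -scalemxAr scalemx_sub // (submx_trans _ (mxmoduleP modU _ (enum_valP j))) //.
  by rewrite submxMr // val_submodP.
rewrite val_factmodE -mulmxA mulmx_sub // -in_factmod_eq0.
by apply/eqP; rewrite -gring_mx_factmod.
Qed.

Lemma gring_regular_eq0 a : gring_mx (regular_repr F G) a = 0 -> a = 0.
Proof. by move=> a0; rewrite -(gring_mxK a) a0 linear0. Qed.

(** The matrix of the linear map from the group algebra to the module that sends [a] to [w a]. *)
Definition orbit_mx n (rG : reprG n) (w : 'rV_n) : 'M_(#|G|, n) :=
  \matrix_j (w *m rG (enum_val j)).

Lemma mul_orbit_mx n (rG : reprG n) (w : 'rV_n) a :
  a *m orbit_mx rG w = w *m gring_mx rG a.
Proof.
rewrite mulmx_sum_row gring_mx_sum mulmx_sumr; apply: eq_bigr => j _.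
by rewrite rowK scalemxAr.
Qed.

Lemma orbit_mx_full n (rG : reprG n) (w : 'rV_n) :
  mx_irreducible rG -> w != 0 -> row_full (orbit_mx rG w).
Proof.
move=> irrG nzw; rewrite -sub1mx; apply/row_subP=> i.
have [_ _ /(_ (cyclic_mx rG w))] := irrG.
have nzW : cyclic_mx rG w != 0.
  by apply: contra nzw => /eqP W0; rewrite -submx0 -W0 cyclic_mx_id.
move/(_ (cyclic_mx_module _ _) (submx1 _) nzW) => sub1W.
have /cyclic_mxP[A /submxP[a defA] ->] := submx_trans (row_sub i _) sub1W.
by apply/submxP; exists a; rewrite mul_orbit_mx /gring_mx /= -defA mxvecK.
Qed.

Section Commutative.
Hypothesis cGG : abelian G.

Lemma centgmx_gring n (rG : reprG n) a : centgmx rG (gring_mx rG a).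
Proof.
apply/centgmxP=> x Gx; rewrite gring_mx_sum mulmx_sumr mulmx_suml.
apply: eq_bigr => j _; rewrite -scalemxAr -scalemxAl -!repr_mxM ?enum_valP //.
by rewrite (centsP cGG _ Gx) ?enum_valP.
Qed.

(** Schur's lemma only gives an inverse matrix; the point is that it comes from the group algebra.
    As [w] generates the module, [w a^-1] is [w b] for some [b]. *)
Lemma gring_mx_inv n (rG : reprG n) a :
    mx_irreducible rG -> gring_mx rG a != 0 ->
  exists b, gring_mx rG a *m gring_mx rG b = 1%:M.
Proof.
move=> irrG nza.
have unit_a := mx_Schur irrG (centgmx_gring rG a) nza.
have nzw : nz_row (1%:M : 'M[F]_n) != 0 by apply: nz_row_mxsimple irrG.
set w := nz_row _ in nzw.
have /submxP[b def_b] : (w *m invmx (gring_mx rG a) <= orbit_mx rG w)%MS.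
  by rewrite submx_full // orbit_mx_full.
exists b; apply: mulmx1C; apply/eqP; rewrite -subr_eq0; apply/negP => /negP nzf.
(* This is [b a - 1] in the group algebra. It kills the nonzero [w], so by Schur's lemma it acts as
   zero. *)
pose c := b *m gring_mx (regular_repr F G) a - gring_row 1%:M.
have fE : gring_mx rG c = gring_mx rG b *m gring_mx rG a - 1%:M.
  by rewrite raddfB /= gring_mxA -gring_opE gring_op1.
rewrite -fE in nzf; have unit_c := mx_Schur irrG (centgmx_gring rG c) nzf.
case/eqP: nzw; rewrite -[w](mulmxK unit_c) fE mulmxBr mulmxA -(mul_orbit_mx rG w b) -def_b.
by rewrite mulmxKV // mulmx1 subrr mul0mx.
Qed.

End Commutative.

(** By Maschke's theorem the regular module, which is faithful, is a sum of simple submodules. *)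
Lemma gring_semisimple a :
    ([pchar F]^'.-group G)%g ->
    (forall n (rG : reprG n), mx_irreducible rG -> gring_mx rG a = 0) ->
  a = 0.
Proof.
move=> F'G irr_a0; apply: gring_regular_eq0; set rG := regular_repr F G.
apply/eqP; have redG := @mx_Maschke_pchar _ _ _ _ rG F'G.
apply: (mx_reducible_semisimple (mxmodule1 rG) redG) => -[I U W simU defW _].
rewrite -[gring_mx _ _]mul1mx -sub_kermx -defW.
apply/sumsmx_subP=> i _; apply/sub_kermxP.
apply: (gring_mx_submod_eq0 (modU := mxsimple_module (simU i))).
by apply: irr_a0; apply/submod_mx_irr.
Qed.
End GroupRingAction.

(** * Evaluation of the group algebra [FA] at characters of [A] with values in [K] *)

Section CharacterFactors.
Variables (aT : finGroupType) (F K : fieldType) (iota : {rmorphism F -> K}).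
Local Notation A := [set: aT]%G.
Local Notation reprA := (mx_representation F A).
Implicit Types (chi : mulchar aT K) (a : 'rV[F]_#|A|).
Hypothesis cAA : abelian A.

Definition mulchar_gring chi a : K :=
  \sum_j iota (a 0 j) * chi (enum_val j).

Lemma mulchar_gringE chi a :
  gring_mx (mulchar_repr chi) (map_mx iota a) = (mulchar_gring chi a)%:M.
Proof.
rewrite gring_mx_sum /mulchar_gring raddf_sum; apply: eq_bigr => j _ /=.
by rewrite mxE scale_scalar_mx.
Qed.

Lemma mulchar_gringB chi : {morph mulchar_gring chi : a b / a - b}.
Proof.
move=> a b; rewrite /mulchar_gring -sumrB; apply: eq_bigr => j _.
by rewrite !mxE rmorphB mulrBl.
Qed.

Lemma mulchar_gringD chi : {morph mulchar_gring chi : a b / a + b}.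
Proof.
move=> a b; rewrite /mulchar_gring -big_split; apply: eq_bigr => j _.
by rewrite !mxE rmorphD mulrDl.
Qed.

Lemma mulchar_gring0 chi : mulchar_gring chi 0 = 0.
Proof. by rewrite /mulchar_gring big1 // => j _; rewrite mxE rmorph0 mul0r. Qed.

(** The product of [FA]: [b] acts by right multiplication on the regular module. *)
Definition gring_mul a b : 'rV[F]_#|A| := a *m gring_mx (regular_repr F A) b.

Lemma gring_mx_mul n (rA : reprA n) a b :
  gring_mx rA (gring_mul a b) = gring_mx rA a *m gring_mx rA b.
Proof. exact: gring_mxA. Qed.

(** The evaluation is the entry of the matrix by which [a] acts on the one-dimensional module of
    [chi]. *)
Lemma mulchar_gringM chi a b :
  mulchar_gring chi (gring_mul a b) = mulchar_gring chi a * mulchar_gring chi b.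
Proof.
have /(congr1 (fun M : 'M_1 => M 0 0)) :
    gring_mx (mulchar_repr chi) (map_mx iota (gring_mul a b)) =
    gring_mx (mulchar_repr chi) (map_mx iota a) *m
    gring_mx (mulchar_repr chi) (map_mx iota b).
  rewrite -gring_mxA map_mxM map_gring_mx; congr (gring_mx _ (_ *m _)).
  by rewrite !gring_mx_sum; apply: eq_bigr => j _; rewrite map_regular_repr.
by rewrite !mulchar_gringE -scalar_mxM !mxE.
Qed.

Definition gring_elt (x : aT) : 'rV[F]_#|A| := gring_row (regular_repr F A x).

Lemma gring_mx_elt n (rA : reprA n) x : gring_mx rA (gring_elt x) = rA x.
Proof. by rewrite -gring_opE gring_opG ?inE. Qed.

Lemma gring_eltE x : gring_elt x = delta_mx 0 (gring_index A x).
Proof.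
by rewrite /gring_elt /gring_row rowK gring_indexK ?inE // mul1g.
Qed.

Lemma mulchar_gring_elt chi x : mulchar_gring chi (gring_elt x) = chi x.
Proof.
rewrite /mulchar_gring gring_eltE (bigD1 (gring_index A x)) //= big1 => [|j nj].
  by rewrite mxE !eqxx rmorph1 mul1r addr0 gring_indexK ?inE.
by rewrite mxE (negPf nj) andbF rmorph0 mul0r.
Qed.

Lemma mulchar_gring1 chi : mulchar_gring chi (gring_elt 1%g) = 1.
Proof. by rewrite mulchar_gring_elt mulchar1. Qed.

Lemma mulchar_gringZ chi k a : mulchar_gring chi (k *: a) = iota k * mulchar_gring chi a.
Proof.
rewrite /mulchar_gring mulr_sumr; apply: eq_bigr => j _.
by rewrite mxE rmorphM mulrA.
Qed.

(** A condition over [F] on annihilators which, for simple modules, amounts to [chi] being a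
    composition factor over [K]. *)
Definition factors_through n (rA : reprA n) chi :=
  forall a, gring_mx rA a = 0 -> mulchar_gring chi a = 0.

(** An element acting as zero on a module still does so after extension of scalars, and then on
    every section. *)
Lemma composition_factor_factors n (rA : reprA n) chi :
  mulchar_composition_factor (map_repr iota rA) chi -> factors_through rA chi.
Proof.
move=> [U [compU [j [_ _ sim]]]] a a0.
have: gring_mx (mulchar_repr chi) (map_mx iota a) = 0.
  apply: gring_mx_rsim sim _; apply: gring_mx_section.
  by rewrite -map_gring_mx a0 map_mx0.
by rewrite mulchar_gringE => /(congr1 (fun M : 'M_1 => M 0 0)); rewrite !mxE.
Qed.

(* With W the matrix of the orbit of a vector w, chi factors through M iff the
   column of values of chi is W *m c for some c; then c is a common eigenvector
   of A, and the quotient by its kernel is a factor of M isomorphic to chi. *)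
Lemma factors_composition_factor n (rA : reprA n) chi :
    mx_irreducible rA -> factors_through rA chi ->
  mulchar_composition_factor (map_repr iota rA) chi.
Proof.
move=> irrA fact_chi; set rK := map_repr iota rA.
have nzw : nz_row (1%:M : 'M[F]_n) != 0 by apply: nz_row_mxsimple irrA.
set w := nz_row _ in nzw.
pose W := orbit_mx rA w; pose X : 'cV[K]_#|A| := \col_j chi (enum_val j).
have fullW : row_full W by rewrite orbit_mx_full.
pose c := map_mx iota (pinvmx W) *m X.
have mulX a : map_mx iota a *m X = (mulchar_gring chi a)%:M.
  apply/matrixP=> r k; rewrite !ord1 !mxE eqxx mulr1n.
  by apply: eq_bigr => j _; rewrite !mxE.
have defX : X = map_mx iota W *m c.
  apply/eqP; rewrite -subr_eq0 mulmxA -{1}[X]mul1mx -mulmxBl -map_mxM.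
  rewrite -(map_mx1 iota) -map_mxB; apply/eqP/row_matrixP=> r.
  (* Since [pinvmx W *m W = 1], a row [a] of [1 - W *m pinvmx W] satisfies [a *m W = 0], that is,
     [a] kills [w]; an [a] acting invertibly cannot. *)
  rewrite row_mul -map_row mulX row0; set a := row r _.
  suffices a0 : gring_mx rA a = 0 by rewrite fact_chi ?raddf0.
  apply/eqP/negP=> /negP/(gring_mx_inv cAA irrA)[b ab1].
  case/eqP: nzw; rewrite -[w]mulmx1 -ab1 mulmxA -(mul_orbit_mx rA w a) -/W.
  by rewrite /a -row_mul mulmxBl mul1mx -mulmxA mulVpmx // mulmx1 subrr row0 mul0mx.
(* [W] is cancelled on the left: acting by [x] permutes the rows of the orbit, and the same
   permutation of [X] scales it by [chi x]. *)
have hom_c x : rK x *m c = chi x *: c.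
  apply: (row_full_inj (A := map_mx iota W)); first by rewrite /row_full mxrank_map.
  rewrite -scalemxAr -defX mulmxA -map_mxM.
  apply/row_matrixP=> r; rewrite row_mul -map_row row_mul rowK -mulmxA -repr_mxM ?inE //.
  have -> : w *m rA (enum_val r * x)%g = row (gring_index A (enum_val r * x)%g) W.
    by rewrite rowK gring_indexK ?inE.
  rewrite map_row -row_mul -defX; apply/matrixP=> k l; rewrite !mxE.
  by rewrite gring_indexK ?inE // mulcharM mulrC.
have nzc : c != 0.
  apply/eqP=> c0; move/matrixP/(_ (gring_index A 1%g) 0)/eqP: defX.
  by rewrite c0 mulmx0 !mxE (negPf (mulchar_neq0 _ _)).
have modV : mxmodule rK (kermx c).
  apply/mxmoduleP=> x _; apply/sub_kermxP.
  by rewrite -mulmxA hom_c -scalemxAr mulmx_ker scaler0.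
have simV : mx_rsim (factmod_repr modV) (mulchar_repr chi).
  exists (val_factmod 1%:M *m c) => [||x _].
  - rewrite mxrank_coker mxrank_ker subKn ?rank_leq_row //.
    by apply/eqP; rewrite eqn_leq rank_leq_col lt0n mxrank_eq0.
  - rewrite -kermx_eq0; apply/rowV0P=> u /sub_kermxP.
    rewrite mulmxA -val_factmodE => /sub_kermxP.
    by rewrite -in_factmod_eq0 val_factmodK => /eqP.
  rewrite mulmxA -val_factmodE (canRL (addKr _) (add_sub_fact_mod _ _)).
  rewrite mulmxDl mulNmx (sub_kermxP (val_submodP _)) oppr0 add0r.
  by rewrite -[LHS]mulmxA hom_c -[LHS]scalemxAr mul_mx_scalar.
have irrV : mx_irreducible (factmod_repr modV).
  apply: mx_rsim_irr (mx_rsim_sym simV) _; apply/mx_irrP; split=> // U _ nzU.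
  by rewrite /row_full eqn_leq rank_leq_row lt0n mxrank_eq0.
(* The empty series refines to a composition series, in which the Jordan-Holder theorem locates the
   simple quotient. *)
have [U [compU lastU _]] : exists U, [/\ mx_composition_series rK U,
    (last 0 U :=: 1%:M)%MS & subseq [::] U].
  by apply/asboolP; apply: (mx_Schreier (rG := rK) (U := [::])) => // ?; apply/asboolP.
have [j simj] := mx_JordanHolder_max compU lastU irrV.
by exists U, compU, j; split=> //; apply: mx_rsim_trans (mx_rsim_sym simj) simV.
Qed.


(** If [a] did not act as zero, some [b] would make [a b - 1] act as zero, whence
    [chi(a) chi(b) = 1]. *)
Lemma irr_factor_eq0 n (rA : reprA n) chi a :
    mx_irreducible rA -> factors_through rA chi -> mulchar_gring chi a = 0 ->
  gring_mx rA a = 0.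
Proof.
move=> irrA fact_chi chi_a0; apply/eqP/negP=> /negP/(gring_mx_inv cAA irrA)[b ab1].
have := fact_chi (gring_mul a b - gring_elt 1%g).
rewrite raddfB /= gring_mx_mul ab1 gring_mx_elt repr_mx1 subrr => /(_ erefl)/eqP.
rewrite mulchar_gringB mulchar_gringM chi_a0 mul0r mulchar_gring1 sub0r.
by rewrite oppr_eq0 oner_eq0.
Qed.

(* A module of least dimension through which chi factors is simple: if a kills a
   submodule and b kills the quotient by it, then b * a kills the module. *)
Lemma exists_irr_factors_through chi :
  exists n (rA : reprA n), mx_irreducible rA /\ factors_through rA chi.
Proof.
pose P n := `[< exists rA : reprA n, factors_through rA chi >].
have exP : exists n, P n.
  exists #|A|; apply/asboolP; exists (regular_repr F A) => a /gring_regular_eq0 ->.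
  exact: mulchar_gring0.
have [n /asboolP[rA fact_chi] min_n] := ex_minnP exP.
exists n, rA; split=> //; apply/mx_irrP; split=> [|U modU nzU].
  (* On the zero module [1] acts as zero, so [chi(1) = 1] would vanish. *)
  rewrite lt0n; apply/eqP=> n0; move: (oner_neq0 K).
  rewrite -(mulchar_gring1 chi) fact_chi ?eqxx // gring_mx_elt.
  by apply/matrixP=> i; have := ltn_ord i; rewrite {2}n0.
rewrite /row_full eqn_leq rank_leq_col leqNgt; apply/negP=> ltUn.
(* By minimality of [n], [chi] factors through no smaller module. *)
have nP m (rA' : reprA m) : (m < n)%N ->
    exists2 a, gring_mx rA' a = 0 & mulchar_gring chi a != 0.
  move=> ltmn; apply: contrapT => noa.
  have /min_n : P m; last by rewrite leqNgt ltmn.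
  apply/asboolP; exists rA' => a a0; apply/eqP/negP=> /negP nza.
  by apply: noa; exists a.
have [a aU0 nza] := nP _ (submod_repr modU) ltUn.
have [|b bU0 nzb] := nP _ (factmod_repr modU).
  by rewrite mxrank_coker ltn_subrL lt0n mxrank_eq0 nzU (leq_ltn_trans _ ltUn).
have /eqP : mulchar_gring chi (gring_mul b a) = 0.
  apply: fact_chi; rewrite gring_mx_mul; apply/sub_kermxP.
  apply: submx_trans (gring_mx_factmod_eq0 bU0) _.
  by apply/sub_kermxP; apply: gring_mx_submod_eq0 aU0.
by rewrite mulchar_gringM mulf_eq0 (negPf nza) (negPf nzb).
Qed.

Lemma mulchar_gring_char_field chi a : mulchar_gring chi a \in in_char_field iota chi.
Proof.
by rewrite rpred_sum // => j _; rewrite rpredM ?char_field_base ?char_field_mulchar.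
Qed.

(** The values of [chi] on [FA] are closed under division: a simple module through which [chi]
    factors supplies the inverses. As they include [F] and all [chi t], they fill [F(chi)]. *)
Lemma mulchar_gring_onto chi x :
  x \in in_char_field iota chi -> exists a, mulchar_gring chi a = x.
Proof.
move/asboolP=> chi_x.
pose L : {pred K} := fun y => `[< exists a, mulchar_gring chi a = y >].
apply/asboolP; apply: (chi_x L) => {x chi_x}[||t].
- split=> [|_ _ /asboolP[a <-] /asboolP[b <-]|_ _ /asboolP[a <-] /asboolP[b <-]].
  + by apply/asboolP; exists (gring_elt 1%g); rewrite mulchar_gring1.
  + by apply/asboolP; exists (a - b); rewrite mulchar_gringB.
  apply/asboolP; have [b0|nzb] := eqVneq (mulchar_gring chi b) 0.
    (* Here the quotient is 0, by the convention [0^-1 = 0]. *)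
    by exists 0; rewrite b0 invr0 mulr0 mulchar_gring0.
  have [n [rA [irrA fact_chi]]] := exists_irr_factors_through chi.
  have /(gring_mx_inv cAA irrA)[c bc1] : gring_mx rA b != 0.
    by apply: contra nzb => /eqP/fact_chi->.
  exists (gring_mul a c); rewrite mulchar_gringM; congr (_ * _).
  apply: (mulfI nzb); rewrite mulfV // -mulchar_gringM; apply/eqP.
  rewrite -subr_eq0 -(mulchar_gring1 chi) -mulchar_gringB; apply/eqP/fact_chi.
  by rewrite raddfB /= gring_mx_mul bc1 gring_mx_elt repr_mx1 subrr.
- move=> a; apply/asboolP; exists (a *: gring_elt 1%g).
  by rewrite mulchar_gringZ mulchar_gring1 mulr1.
by apply/asboolP; exists (gring_elt t); rewrite mulchar_gring_elt.
Qed.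

Variables (I : {fset mulchar aT K}) (HI : is_Irr iota I).

Lemma Irr_gring_eq0 a : ([pchar F]^'.-group A)%g ->
  (forall chi, chi \in I -> mulchar_gring chi a = 0) -> a = 0.
Proof.
move=> F'A a0; apply: gring_semisimple => // n rA irrA.
have [chi [[Ichi /composition_factor_factors fact_chi] _]] := HI irrA.
exact: irr_factor_eq0 irrA fact_chi (a0 chi Ichi).
Qed.

(** Otherwise [chi] would factor through every module that [psi] factors through, in particular a
    simple one; both would be composition factors of it, against the uniqueness in [is_Irr]. *)
Lemma Irr_separation chi psi : chi \in I -> psi \in I -> psi != chi ->
  exists2 a, mulchar_gring chi a != 0 & mulchar_gring psi a = 0.
Proof.
move=> Ichi Ipsi ne; apply: contrapT => noa.
have [n [rA [irrA fact_psi]]] := exists_irr_factors_through psi.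
have fact_chi : factors_through rA chi.
  move=> a /fact_psi psi_a0; apply/eqP/negP=> /negP nza.
  by apply: noa; exists a.
have [chi0 [_ uniq0]] := HI irrA.
case/eqP: ne; transitivity chi0; [symmetry|]; apply: uniq0; split=> //;
  exact: factors_composition_factor.
Qed.

(** As in the Chinese remainder theorem, a product of separating elements vanishes at every other
    character of [I] but not at [chi]; a further factor adjusts its value at [chi] to [x]. *)
Lemma Irr_gring_delta chi x : chi \in I -> x \in in_char_field iota chi ->
  exists2 a, mulchar_gring chi a = x &
    forall psi, psi \in I -> psi != chi -> mulchar_gring psi a = 0.
Proof.
move=> Ichi chi_x.
(* Membership in the list is kept apart from membership in [I], so that the induction shortens the
   list alone; entries outside [I] or equal to [chi] contribute no factor. *)
have [b nzb b0] : exists2 b, mulchar_gring chi b != 0 &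
    forall psi, psi \in enum_fset I -> psi \in I -> psi != chi ->
      mulchar_gring psi b = 0.
  elim: (enum_fset I) => [|psi s [b nzb b0]].
    by exists (gring_elt 1%g); rewrite ?mulchar_gring1 ?oner_neq0.
  have [Ipsi|nIpsi] := boolP ((psi \in I) && (psi != chi)); last first.
    exists b => // psi' /predU1P[->|]; last exact: b0.
    by move=> Ipsi ne; rewrite Ipsi ne in nIpsi.
  case/andP: Ipsi => Ipsi ne; have [c nzc c0] := Irr_separation Ichi Ipsi ne.
  exists (gring_mul b c); first by rewrite mulchar_gringM mulf_neq0.
  move=> psi' + Ipsi' ne'; rewrite mulchar_gringM.
  by case/predU1P=> [->|/b0->]; rewrite ?c0 ?mulr0 ?mul0r.
have [|c chi_c] := @mulchar_gring_onto chi (x / mulchar_gring chi b).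
  by rewrite rpred_div ?mulchar_gring_char_field.
exists (gring_mul c b); first by rewrite mulchar_gringM chi_c divfK.
by move=> psi Ipsi ne; rewrite mulchar_gringM b0 ?mulr0.
Qed.

Lemma Irr_gring_onto (y : mulchar aT K -> K) :
    (forall chi, chi \in I -> y chi \in in_char_field iota chi) ->
  exists a, forall chi, chi \in I -> mulchar_gring chi a = y chi.
Proof.
move=> y_in.
(* The second condition serves the induction on the list: characters not yet treated still have
   value 0, so adding an element supported at the next one gives it the right value. *)
have [a a_y _] : exists2 a, 
    (forall chi, chi \in enum_fset I -> mulchar_gring chi a = y chi) &
    (forall chi, chi \in I -> chi \notin enum_fset I -> mulchar_gring chi a = 0).
  have: {subset enum_fset I <= I} by [].
  have := fset_uniq I; elim: (enum_fset I) => [_ _|chi s IHs /= /andP[nchi Us] sI].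
    by exists 0 => // chi _ _; apply: mulchar_gring0.
  have [|a a_y a0] := IHs Us; first by move=> psi s_psi; apply: sI; apply/predU1P; right.
  have Ichi : chi \in I by apply: sI; apply: mem_head.
  have [b b_y b0] := Irr_gring_delta Ichi (y_in _ Ichi).
  exists (a + b) => psi; rewrite mulchar_gringD.
    case/predU1P=> [->|s_psi]; first by rewrite a0 // b_y add0r.
    rewrite a_y // b0 ?addr0 //; first by apply: sI; apply/predU1P; right.
    by apply: contraNneq nchi => <-.
  by move=> Ipsi; rewrite inE negb_or => /andP[ne nspsi]; rewrite a0 // b0 // addr0.
by exists a.
Qed.

End CharacterFactors.

(** * Coordinates on [S] from the central extension *)

Section CentralExtensionCoordinates.
Variables (aT sT gT : finGroupType).
Variables (i : {morphism [set: aT] >-> sT}) (p : {morphism [set: sT] >-> gT}).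
Hypothesis Hext : central_extension i p.

Lemma central_extension_morph x y : p (x * y)%g = (p x * p y)%g.
Proof. by rewrite morphM ?inE. Qed.

Lemma central_extension_kernel t : p (i t) = 1%g.
Proof.
have [_ im_i _ _] := Hext; apply/(kerP p (in_setT _)).
by rewrite -im_i mem_morphim ?inE.
Qed.

Lemma central_extension_commute t x : (i t * x = x * i t)%g.
Proof.
have [_ _ _ /subsetP ZS] := Hext.
have /centerP[_ cSt] : i t \in 'Z([set: sT])%g by rewrite ZS ?mem_morphim ?inE.
by apply: cSt; rewrite inE.
Qed.

Lemma central_extension_inj : injective i.
Proof.
have [/injmP inj_i _ _ _] := Hext.
by move=> t u; apply: inj_i; rewrite inE.
Qed.

Lemma central_extension_abelian : abelian [set: aT].
Proof.
apply/centsP=> t _ u _; apply: central_extension_inj.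
by rewrite !morphM ?inE // central_extension_commute.
Qed.

(** The cocycle [sigma] is only cohomologous to that of the section [s]. Correcting [s] by the
    cochain [l] gives a section with cocycle exactly [sigma], and [e t g] is [i t] times its value
    at [g]. *)
Lemma central_extension_coordinates (sigma : gT -> gT -> aT) :
    extension_class i p sigma ->
  exists (e : aT -> gT -> sT) (tau : sT -> aT),
    [/\ forall t g, p (e t g) = g, forall t g, tau (e t g) = t,
        forall x, e (tau x) (p x) = x
      & forall x y, tau (x * y)%g = (tau x * tau y * sigma (p x) (p y))%g].
Proof.
move=> [s [sigma0 [ps s_mul [l sigmaE]]]].
have [_ im_i _ _] := Hext.
have iM t u : i (t * u)%g = (i t * i u)%g by rewrite morphM ?inE.
pose e t g := (i t * (i (l g) * s g))%g.
have pe t g : p (e t g) = g.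
  by rewrite !central_extension_morph !central_extension_kernel !mul1g ps.
have e_inj g : injective (e^~ g).
  by move=> t u /mulIg; apply: central_extension_inj.
have e_onto x : exists t, e t (p x) = x.
  have : (x * (i (l (p x)) * s (p x))^-1 \in 'ker p)%g.
    apply/kerP; rewrite ?inE // central_extension_morph morphV ?inE //.
    by rewrite central_extension_morph central_extension_kernel mul1g ps mulgV.
  rewrite -im_i => /morphimP[t _ _ def_t].
  by exists t; rewrite /e -def_t mulgKV.
have [tau tauE] := choice e_onto.
exists e, tau; split=> // [t g|x y].
  by apply: (e_inj g); have := tauE (e t g); rewrite pe.
(* With its second argument fixed, [e] is injective, so it is enough to compare in [S], where the
   factors from [A] are central. *)
apply: (e_inj (p (x * y)%g)); rewrite tauE.
rewrite -[in LHS](tauE x) -[in LHS](tauE y) /e central_extension_morph.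
set g := p x; set h := p y; rewrite sigmaE !iM.
have cAA (t u : aT) : (t * u = u * t)%g.
  exact: (centsP central_extension_abelian t (in_setT t) u (in_setT u)).
have cS t x' : (s x' * i t = i t * s x')%g by rewrite central_extension_commute.
have -> : (i (tau x) * (i (l g) * s g) * (i (tau y) * (i (l h) * s h))
           = i (tau x) * (i (l g) * (i (tau y) * (i (l h) * (s g * s h)))))%g.
  by rewrite -!mulgA (mulgA (s g)) cS -(mulgA (i (tau y))) (mulgA (s g)) cS !mulgA.
rewrite s_mul !mulgA -!iM; congr (i _ * _)%g; rewrite mulgKV.
rewrite -!mulgA; congr (_ * _)%g.
by rewrite (mulgA (l g)) (cAA (l g)) -mulgA; congr (_ * _)%g; rewrite mulgA cAA.
Qed.

End CentralExtensionCoordinates.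

(** * Morphisms out of a twisted group algebra *)

Lemma twbasis_scaleE (X : finGroupType) (E : fieldType) (c : cocycle2 X E) k x y :
  (k *: twbasis c x) y = if y == x then k else 0.
Proof. by rewrite !ffunE; case: eqP => _; [exact: mulr1 | exact: mulr0]. Qed.

Section TwistedLift.
Variables (X : finGroupType) (E E' : fieldType) (c : cocycle2 X E).
Variables (j : {rmorphism E -> E'}) (B : algType E') (phi : X -> B).

(** The extension of [u_x |-> phi x] that is semilinear along [j]. *)
Definition twlift (a : twalg c) : B := \sum_x j (a x) *: phi x.

Lemma twlift_zmod_morphism : zmod_morphism twlift.
Proof.
move=> a b; rewrite /twlift -sumrB; apply: eq_bigr => x _.
by rewrite !ffunE rmorphB scalerBl.
Qed.

Hypothesis phi1 : phi 1%g = j (c 1%g 1%g) *: 1.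
Hypothesis phiM : forall x y, phi x * phi y = j (c x y) *: phi (x * y)%g.

(** The unit is [c(1,1)^-1 u_1], as cocycles need not be normalized; hence the scalar in [phi1].
    Products are compared after the substitution [z = x y]. *)
Lemma twlift_monoid_morphism : monoid_morphism twlift.
Proof.
split=> [|a b].
  rewrite /twlift (bigD1 1%g) //= big1 ?addr0 => [|x /negPf nx].
    rewrite !ffunE eqxx phi1 [X in j X](_ : _ = (c 1%g 1%g)^-1); last exact: mulr1.
    by rewrite scalerA -rmorphM mulVf ?cocycle2_neq0 // rmorph1 scale1r.
  by rewrite !ffunE nx scaler0 rmorph0 scale0r.
rewrite /twlift mulr_suml.
under eq_bigr => z _ do rewrite ffunE rmorph_sum scaler_suml.
rewrite exchange_big; apply: eq_bigr => x _ /=.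
rewrite (reindex_inj (mulgI x)) mulr_sumr; apply: eq_bigr => y _ /=.
rewrite mulKg -[RHS]scalerAl -[in RHS]scalerAr phiM !scalerA !rmorphM.
by rewrite -!mulrA.
Qed.

Lemma twliftZ k a : twlift (k *: a) = j k *: twlift a.
Proof.
rewrite /twlift scaler_sumr; apply: eq_bigr => x _.
by rewrite ffunE rmorphM scalerA.
Qed.

Definition twlift_rmorphism : {rmorphism twalg c -> B} :=
  HB.pack twlift
    (GRing.isZmodMorphism.Build (twalg c) B twlift twlift_zmod_morphism)
    (GRing.isMonoidMorphism.Build (twalg c) B twlift twlift_monoid_morphism).

End TwistedLift.

(** * Morphisms into a direct sum of rings *)

Section DirectSumMorphism.
Variables (R : pzRingType) (I : finType) (S : I -> pzRingType).
Variable g : forall i, {rmorphism R -> S i}.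

Definition dsum_pair (a : R) : dsum S := mkdsum (fun i => g i a).

Lemma dsum_pair_zmod_morphism : zmod_morphism dsum_pair.
Proof.
move=> a b; apply/ffunP=> i; rewrite mkdsumE rmorphB.
by rewrite [RHS]mkdsumE mkdsumE [X in _ = _ + X]mkdsumE mkdsumE.
Qed.

Lemma dsum_pair_monoid_morphism : monoid_morphism dsum_pair.
Proof.
split=> [|a b]; apply/ffunP=> i.
  by rewrite mkdsumE rmorph1 [RHS]mkdsumE.
by rewrite mkdsumE rmorphM [RHS]mkdsumE !mkdsumE.
Qed.

HB.instance Definition _ :=
  GRing.isZmodMorphism.Build R (dsum S) dsum_pair dsum_pair_zmod_morphism.
HB.instance Definition _ :=
  GRing.isMonoidMorphism.Build R (dsum S) dsum_pair dsum_pair_monoid_morphism.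

End DirectSumMorphism.

(** * The isomorphism, assembled from the evaluations on the cosets of [A] *)

Theorem theorem5p3
  (aT sT gT : finGroupType)
  (i : {morphism [set: aT] >-> sT}) (p : {morphism [set: sT] >-> gT})
  (Hext : central_extension i p)
  (F : fieldType) (HF : forall q : nat, q \in [pchar F] -> ~~ (q %| #|aT|)%N)
  (alpha : cocycle2 sT F) (alpha' : cocycle2 gT F)
  (Hinf : cohomologous alpha (inflation p alpha'))
  (sigma : gcocycle2 gT aT) (Hsigma : extension_class i p sigma)
  (K : fieldType) (iota : {rmorphism F -> K}) (z : K)
  (Hz : (exponent [set: aT]).-primitive_root z)
  (Irr : {fset mulchar aT K}) (HIrr : is_Irr iota Irr) :
  exists f : {rmorphism twalg alpha ->
      dsum (fun chi : Irr => twalg (char_cocycle iota (val chi) alpha' sigma))},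
    bijective f /\
    forall (a : F) (x : twalg alpha) (chi : Irr),
      f (a *: x) chi = char_field_inj iota (val chi) a *: f x chi.
Proof.
have cAA := central_extension_abelian Hext.
have [e [tau [pe taue eK tauM]]] := central_extension_coordinates Hext Hsigma.
have [lam nz_lam alphaE] := Hinf.
have pM := central_extension_morph p.
pose cc (chi : mulchar aT K) := char_cocycle iota chi alpha' sigma.
pose j (chi : mulchar aT K) : {rmorphism F -> char_field iota chi} := char_field_inj iota chi.
pose phi (chi : mulchar aT K) (x : sT) : twalg (cc chi) :=
  (j chi (lam x) * char_field_char iota chi (tau x)) *: twbasis (cc chi) (p x).
have p1 : p 1%g = 1%g by rewrite morph1.
(* The coboundary of [lam] turns the inflated cocycle into [alpha], and the factor [sigma] in the
   rule for [tau] accounts for [chi(sigma(g,h))] in [alpha_chi]. *)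
have phiM chi x y : phi chi x * phi chi y = j chi (alpha x y) *: phi chi (x * y)%g.
  rewrite /phi -scalerAl -scalerAr twbasisM !scalerA -pM; congr (_ *: _).
  apply: val_inj; rewrite /= alphaE /inflation tauM !mulcharM !rmorphM /= fmorphV.
  by field; rewrite fmorph_eq0.
have phi1 chi : phi chi 1%g = j chi (alpha 1%g 1%g) *: 1.
  (* The section need not send 1 to 1, so [tau 1] may be nontrivial; the rule for [tau] at [(1,1)]
     forces [tau 1 * sigma 1 1 = 1]. *)
  have /eqP : tau 1%g = (tau 1 * tau 1 * sigma 1 1)%g by rewrite -{1}(mulg1 1%g) tauM p1.
  rewrite -[eqbLHS]mulg1 -mulgA (inj_eq (mulgI _)) => /eqP tau1.
  rewrite /phi [1 in RHS]/(twone _) /twone scalerA p1; congr (_ *: _).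
  have chi_tau1 : chi (tau 1%g) * chi (sigma 1%g 1%g) = 1.
    by rewrite -mulcharM -tau1 mulchar1.
  apply: val_inj; rewrite /= alphaE /inflation p1 mulg1 mulfK //.
  have nz_chi := mulchar_neq0 chi (sigma 1%g 1%g).
  have -> : chi (tau 1%g) = (chi (sigma 1%g 1%g))^-1.
    by apply: (mulIf nz_chi); rewrite chi_tau1 mulVf.
  by rewrite rmorphM; field; rewrite nz_chi fmorph_eq0 cocycle2_neq0.
have [f fE] : exists f : {rmorphism twalg alpha ->
      dsum (fun chi : Irr => twalg (char_cocycle iota (val chi) alpha' sigma))},
    forall a chi, f a chi = twlift (j (val chi)) (phi (val chi)) a.
  exists (dsum_pair (fun chi : Irr => twlift_rmorphism (phi1 (val chi)) (phiM (val chi)))).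
  by move=> a chi; exact: mkdsumE.
exists f; split; last by move=> a x chi; rewrite (fE (a *: x)) (fE x); exact: twliftZ.
(* The part of [a] on the coset over [g], weighted by [lam] and viewed in [FA] through
   [t |-> e t g]. *)
pose coef (a : twalg alpha) g : 'rV[F]_#|[set: aT]%G| :=
  \row_k (a (e (enum_val k) g) * lam (e (enum_val k) g)).
have f_val a (chi : Irr) g : val (f a chi g) = mulchar_gring iota (val chi) (coef a g).
  rewrite fE sum_ffunE raddf_sum /=.
  rewrite (eq_bigr (fun x => if p x == g then
      iota (a x * lam x) * val chi (tau x) else 0)) => [|x _]; last first.
    rewrite /phi scalerA twbasis_scaleE eq_sym; case: eqP => // _.
    by rewrite /= rmorphM mulrA.
  (* The fibre of [p] over [g] is parametrized by [A] through [e], with inverse [tau]. *)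
  rewrite -big_mkcond /= (reindex_onto (fun k : 'I_#|[set: aT]%G| => e (enum_val k) g)
    (fun x => gring_index [set: aT]%G (tau x))) => [|x /eqP <-]; last first.
    by rewrite gring_indexK ?inE // eK.
  rewrite (eq_bigl predT) => [|k]; last by rewrite pe taue gring_valK !eqxx.
  by apply: eq_bigr => k _; rewrite mxE taue.
have f_inj : injective f.
  move=> a b eq_ab; apply/ffunP=> x; apply: (mulIf (nz_lam x)).
  have : coef a (p x) = coef b (p x).
    apply: subr0_eq; apply: (Irr_gring_eq0 cAA HIrr) => [|chi Ichi].
      apply/pnatP=> // q _ q_dvd; apply/negP=> /HF.
      by rewrite -cardsT q_dvd.
    rewrite mulchar_gringB.
    have := f_val a [` Ichi]%fset (p x).
    by rewrite eq_ab f_val /= => ->; rewrite subrr.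
  move/rowP/(_ (gring_index [set: aT]%G (tau x))).
  by rewrite !mxE gring_indexK ?inE // eK.
have f_onto y : exists a : twalg alpha, f a = y.
  have b_y g : exists b : 'rV[F]_#|[set: aT]%G|, forall chi : Irr,
      mulchar_gring iota (val chi) b = val (y chi g).
    (* [Irr_gring_onto] takes a family indexed by all characters; the default 0 fills the values
       outside [Irr]. *)
    pose yg (chi : mulchar aT K) : K :=
      oapp (fun psi : Irr => val (y psi g)) 0 (insub chi).
    have ygE chi (Ichi : chi \in Irr) : yg chi = val (y [` Ichi]%fset g).
      by rewrite /yg (insubT (mem Irr) Ichi).
    have [chi Ichi|b b_y] := @Irr_gring_onto _ _ _ iota cAA _ HIrr yg.
      by rewrite ygE; apply: valP.
    by exists b; case=> chi Ichi; rewrite b_y ?ygE.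
  have [b {}b_y] := choice b_y.
  (* Each coset carries the solution [b g], divided by the weights [lam] that [coef] puts in. *)
  pose a : twalg alpha :=
    [ffun x => b (p x) 0 (gring_index [set: aT]%G (tau x)) / lam x].
  exists a; apply/ffunP=> chi; apply/ffunP=> g; apply: val_inj.
  rewrite f_val -b_y; congr mulchar_gring; apply/rowP=> k.
  by rewrite mxE ffunE pe taue gring_valK divfK.
have [f' f'K] := choice f_onto.
by exists f' => // a; apply: f_inj; rewrite f'K.
Qed.
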